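(* The incidence version of Pappus' Theorem is false in the tropical projective plane $\mathbb{TP}^2$: there exist nine distinct tropical lines $a,a',a'',b,b',b'',c,c',c''$ in $\mathbb{TP}^2$ such that each of the eight triples $$[a,a',a''],\ [b,b',b''],\ [c,c',c''],\ [a,b,c],\ [a',b',c'],\ [a'',b,c'],\ [a',b'',c],\ [a,b',c'']$$ is concurrent, but the triple $[a'',b'',c'']$ is not concurrent.
   Context: $\mathbb{TP}^2=\mathbb{R}^3/\mathbb{R}(1,1,1)$. The tropical line with coefficients $u=(u_1,u_2,u_3)\in\mathbb{R}^3$ is the set of all $(x,y,z)\in\mathbb{TP}^2$ such that the minimum of $u_1+x,\ u_2+y,\ u_3+z$ is attained at least twice. Three tropical lines are concurrent if they have a point in common. *)

(* Defs.v *)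
From mathcomp Require Import all_boot all_order all_algebra.
From mathcomp Require Import boolp classical_sets reals.

Set Implicit Arguments.
Unset Strict Implicit.
Unset Printing Implicit Defensive.

Import Order.TTheory GRing.Theory Num.Theory.

Local Open Scope ring_scope.
Local Open Scope quotient_scope.
Local Open Scope classical_set_scope.

Section TropicalPlane.
Variable R : realType.

Definition tp_equiv (x y : 'rV[R]_3) : bool :=
  `[< exists c : R, y = x + const_mx c >].

Lemma tp_equiv_refl : reflexive tp_equiv.
Proof. by move=> x; apply/asboolP; exists 0; rewrite raddf0 addr0. Qed.

Lemma tp_equiv_sym : symmetric tp_equiv.
Proof.
suff H x y : tp_equiv x y -> tp_equiv y x by move=> x y; apply/idP/idP; exact: H.
move=> /asboolP[c ->]; apply/asboolP; exists (- c).
by rewrite raddfN addrK.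
Qed.

Lemma tp_equiv_trans : transitive tp_equiv.
Proof.
move=> y x z /asboolP[c ->] /asboolP[d ->]; apply/asboolP; exists (c + d).
by rewrite raddfD addrA.
Qed.

Canonical tp_equiv_equiv :=
  EquivRel tp_equiv tp_equiv_refl tp_equiv_sym tp_equiv_trans.

Definition TP2 : Type := {eq_quot tp_equiv}.

Definition min_attained_twice (w : 'rV[R]_3) : Prop :=
  exists i j : 'I_3,
    i != j /\ forall k : 'I_3, w 0 i <= w 0 k /\ w 0 j <= w 0 k.

Definition tropical_line (u : 'rV[R]_3) : set TP2 :=
  [set \pi_TP2 x | x in [set x : 'rV[R]_3 | min_attained_twice (u + x)]].

(* The condition on [x] does not depend on its class modulo (1,1,1), so testing
   some representative in [tropical_line] is the same as testing any of them. *)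
Lemma tropical_lineE (u x : 'rV[R]_3) :
  tropical_line u (\pi_TP2 x) <-> min_attained_twice (u + x).
Proof.
split=> [[y ymin /eqP]|xmin]; last by exists x.
rewrite eqmodE => /asboolP[c ->].
case: ymin => i [j [ij ymin]]; exists i, j; split=> // k.
by have [] := ymin k; rewrite !mxE !addrA !lerD2r.
Qed.

Definition is_tropical_line (L : set TP2) : Prop :=
  exists u : 'rV[R]_3, L = tropical_line u.

Definition concurrent (L1 L2 L3 : set TP2) : Prop :=
  L1 `&` L2 `&` L3 !=set0.

End TropicalPlane.

(* Main.v *)
(* The nine lines come from a computer search over coefficients (m, n, 0) with
   0 <= m, n <= 3: three lines are concurrent exactly when the minimum in the
   tropical determinant of their coefficients is attained at least twice, and
   the search imposes this for eight triples and its failure for the ninth. *)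
Require Import Defs.
From mathcomp Require Import all_boot all_order all_algebra.
From mathcomp Require Import boolp classical_sets reals.
From mathcomp Require Import lra.

Set Implicit Arguments.
Unset Strict Implicit.
Unset Printing Implicit Defensive.

Import Order.TTheory GRing.Theory Num.Theory.

Local Open Scope ring_scope.
Local Open Scope quotient_scope.
Local Open Scope classical_set_scope.

Section TropicalLines.
Variable R : realType.
Implicit Types x y z a b c : R.

Definition row3 x y z : 'rV[R]_3 := \row_i [:: x; y; z]`_i.

Lemma add_row3 a b c x y z :
  row3 a b c + row3 x y z = row3 (a + x) (b + y) (c + z).
Proof. by apply/rowP => -[[|[|[|]]] // ?]; rewrite !mxE. Qed.

Lemma row3_eta (w : 'rV[R]_3) : w = row3 (w 0 0) (w 0 1) (w 0 2).
Proof.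
by apply/rowP => -[[|[|[|]]] // ?]; rewrite !mxE /=; congr (w _ _); apply/val_inj.
Qed.

Lemma min_attained_twice_row3 x y z :
  min_attained_twice (row3 x y z) <->
  (x = y /\ x <= z) \/ (x = z /\ x <= y) \/ (y = z /\ y <= x).
Proof.
split=> [[i [j [ij wmin]]]|].
  have := wmin 0; have := wmin 1; have := wmin 2.
  case: i j ij {wmin} => [[|[|[|]]] // ?] [[|[|[|]]] // ?] //= _;
    rewrite !mxE /=; lra.
by case=> [[xy xz]|[[xz xy]|[yz yx]]];
  [exists 0, 1|exists 0, 2|exists 1, 2]; split=> // -[[|[|[|]]] // ?];
  rewrite !mxE /=; lra.
Qed.

Lemma tropical_line_row3 a b c x y z :
  tropical_line (row3 a b c) (\pi_(TP2 R) (row3 x y z)) <->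
  (a + x = b + y /\ a + x <= c + z) \/
  (a + x = c + z /\ a + x <= b + y) \/
  (b + y = c + z /\ b + y <= a + x).
Proof. by rewrite tropical_lineE add_row3 min_attained_twice_row3. Qed.

(* Far out on the ray in direction [e_i] from the apex of the first line, only
   the two other coordinates can attain the minimum for the second line, so the
   coefficients differ by the same amount in these two coordinates. *)
Lemma tropical_line_row3_inj a b c a' b' c' :
  tropical_line (row3 a b c) = tropical_line (row3 a' b' c') ->
  a - a' = c - c' /\ b - b' = c - c'.
Proof.
move=> eqL.
(* These bounds make the raised coordinate exceed the other of the first two on the second line, so
   it cannot share the minimum even with the third. *)
have [t [t0 ltN lt]] : exists t, [/\ 0 <= t, - t < (a' - a) - (b' - b)
    & (a' - a) - (b' - b) < t].
  exists (`|(a' - a) - (b' - b)| + 1); split; first by rewrite addr_ge0.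
    by rewrite ltrNl ltr_pwDr // -normrN ler_norm.
  by rewrite ltr_pwDr // ler_norm.
have : tropical_line (row3 a' b' c') (\pi_(TP2 R) (row3 (- a) (t - b) (- c))).
  by rewrite -eqL tropical_line_row3; lra.
have : tropical_line (row3 a' b' c') (\pi_(TP2 R) (row3 (t - a) (- b) (- c))).
  by rewrite -eqL tropical_line_row3; lra.
by rewrite !tropical_line_row3; lra.
Qed.

Lemma concurrent_row3 x y z (L1 L2 L3 : set (TP2 R)) :
  L1 (\pi_(TP2 R) (row3 x y z)) -> L2 (\pi_(TP2 R) (row3 x y z)) ->
  L3 (\pi_(TP2 R) (row3 x y z)) -> concurrent L1 L2 L3.
Proof. by exists (\pi_(TP2 R) (row3 x y z)). Qed.

(** Fixing the last coefficient at 0 leaves one coefficient vector per line. Pairs of naturals make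
    distinctness of the nine lines decidable by evaluation. *)
Definition nat_line (p : nat * nat) : set (TP2 R) :=
  tropical_line (row3 p.1%:R p.2%:R 0).

Lemma nat_line_inj : injective nat_line.
Proof.
move=> [m n] [m' n'] /tropical_line_row3_inj [/= em en].
by congr (_, _); apply/eqP; rewrite -(eqr_nat R); apply/eqP; lra.
Qed.

End TropicalLines.

Theorem mainTheorem3 (R : realType) :
  exists a a' a'' b b' b'' c c' c'' : set (TP2 R),
    (forall L : set (TP2 R),
        L \in [:: a; a'; a''; b; b'; b''; c; c'; c''] -> is_tropical_line L) /\
    uniq [:: a; a'; a''; b; b'; b''; c; c'; c''] /\
    concurrent a a' a'' /\
    concurrent b b' b'' /\
    concurrent c c' c'' /\
    concurrent a b c /\
    concurrent a' b' c' /\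
    concurrent a'' b c' /\
    concurrent a' b'' c /\
    concurrent a b' c'' /\
    ~ concurrent a'' b'' c''.
Proof.
pose l m n := @nat_line R (m, n).
exists (l 1 3)%N, (l 1 1)%N, (l 0 0)%N, (l 1 2)%N, (l 0 3)%N, (l 0 2)%N.
exists (l 2 1)%N, (l 3 1)%N, (l 2 3)%N.
pose coeffs : seq (nat * nat) :=
  [:: (1, 3); (1, 1); (0, 0); (1, 2); (0, 3); (0, 2); (2, 1); (3, 1); (2, 3)]%N.
split.
  move=> L; rewrite -[X in L \in X]/(map (@nat_line R) coeffs) => /mapP[p _ ->].
  by exists (row3 p.1%:R p.2%:R 0).
split.
  (* By injectivity of [nat_line], only [uniq coeffs] remains, which computes. *)
  rewrite -[X in uniq X]/(map (@nat_line R) coeffs).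
  by rewrite (map_inj_uniq (@nat_line_inj R)).
rewrite /l /nat_line /=.
(* Each witness is a common point scaled to last coordinate 0; [(-1, -1, 0)] serves three triples
   and [(0, -1, 0)] two. *)
split; first by apply: (@concurrent_row3 R (-1) (-1) 0); rewrite tropical_line_row3; lra.
split; first by apply: (@concurrent_row3 R 0 (-2) 0); rewrite tropical_line_row3; lra.
split; first by apply: (@concurrent_row3 R (-2) (-1) 0); rewrite tropical_line_row3; lra.
split; first by apply: (@concurrent_row3 R (-1) (-1) 0); rewrite tropical_line_row3; lra.
split; first by apply: (@concurrent_row3 R 0 (-1) 0); rewrite tropical_line_row3; lra.
split; first by apply: (@concurrent_row3 R (-1) (-1) 0); rewrite tropical_line_row3; lra.
split; first by apply: (@concurrent_row3 R 0 (-1) 0); rewrite tropical_line_row3; lra.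
split; first by apply: (@concurrent_row3 R 0 (-3) 0); rewrite tropical_line_row3; lra.
(* For [w = (x, y, z)], the lines with coefficients [(0, 0, 0)] and [(0, 2, 0)] force [x = z <= y].
   Then [z] is strictly below [x + 2] and [y + 3], so the line [(2, 3, 0)] misses the point. *)
move=> [p [[]]]; elim/quotW: p => w; rewrite (row3_eta w) !tropical_line_row3.
lra.
Qed.
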